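(* Let $(A,\ast,\curlyvee_0)$ be an NS-commutative algebra and let $(A[\![t]\!],\prec_t,\succ_t,\curlyvee_t)$ be an NS-algebra deformation of it, with $$x\prec_ty=\sum_{i\ge0}(x\prec_iy)t^i,\quad x\succ_ty=\sum_{i\ge0}(x\succ_iy)t^i,\quad x\curlyvee_ty=\sum_{i\ge0}(x\curlyvee_iy)t^i,\qquad x,y\in A.$$ Define bilinear maps $\diamond,\bullet:A\times A\to A$ by $$x\diamond y:=\frac{x\succ_ty-y\prec_tx}{t}\Big|_{t=0}=x\succ_1y-y\prec_1x,\qquad x\bullet y:=\frac{x\curlyvee_ty-y\curlyvee_tx}{t}\Big|_{t=0}=x\curlyvee_1y-y\curlyvee_1x.$$ Then $(A,\ast,\curlyvee_0,\diamond,\bullet)$ is an NS-Poisson algebra.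
   Context: All vector spaces and (multi)linear maps are over a field $\mathbf{k}$ of characteristic $0$. An NS-algebra is a quadruple $(A,\prec,\succ,\curlyvee)$ of a vector space $A$ (or a module over a commutative ring such as $\mathbf{k}[\![t]\!]$, with operations bilinear over it) with bilinear operations $\prec,\succ,\curlyvee$ such that for all $x,y,z$, with $x\odot y=x\prec y+x\succ y+x\curlyvee y$: $$(x\prec y)\prec z=x\prec(y\odot z),\quad (x\succ y)\prec z=x\succ(y\prec z),\quad (x\odot y)\succ z=x\succ(y\succ z),$$ $$(x\curlyvee y)\prec z+(x\odot y)\curlyvee z=x\succ(y\curlyvee z)+x\curlyvee(y\odot z).$$ An NS-commutative algebra is a triple $(A,\ast,\curlyvee)$ of a vector space $A$ with bilinear operations $\ast,\curlyvee$, where $\curlyvee$ is commutative, such that for all $x,y,z\in A$, with $x\odot y=x\ast y+y\ast x+x\curlyvee y$: $$x\ast(y\ast z)=(x\odot y)\ast z,\qquad x\ast(y\curlyvee z)+x\curlyvee(y\odot z)=y\ast(x\curlyvee z)+y\curlyvee(x\odot z).$$ An NS-commutative algebra $(A,\ast,\curlyvee_0)$ is regarded as an NS-algebra $(A,\prec_0,\succ_0,\curlyvee_0)$ via $x\succ_0y=y\prec_0x=x\ast y$. An NS-algebra deformation of $(A,\ast,\curlyvee_0)$ consists of $\mathbf{k}[\![t]\!]$-bilinear maps $\prec_t,\succ_t,\curlyvee_t:A[\![t]\!]\times A[\![t]\!]\to A[\![t]\!]$ of the form $x\prec_ty=\sum_{i\ge0}(x\prec_iy)t^i$, $x\succ_ty=\sum_{i\ge0}(x\succ_iy)t^i$,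 $x\curlyvee_ty=\sum_{i\ge0}(x\curlyvee_iy)t^i$ for $x,y\in A$ (with bilinear maps $\prec_i,\succ_i,\curlyvee_i:A\times A\to A$ and with the $i=0$ terms being the given $\prec_0,\succ_0,\curlyvee_0$) such that $(A[\![t]\!],\prec_t,\succ_t,\curlyvee_t)$ is an NS-algebra over $\mathbf{k}[\![t]\!]$. An NS-Lie algebra is a triple $(A,\diamond,\bullet)$ of a vector space $A$ with bilinear operations $\diamond,\bullet$, where $\bullet$ is skew-symmetric, such that for all $x,y,z\in A$, with $\{\!\!\{x,y\}\!\!\}=x\diamond y-y\diamond x+x\bullet y$: $$x\diamond(y\diamond z)-(x\diamond y)\diamond z-y\diamond(x\diamond z)+(y\diamond x)\diamond z=(x\bullet y)\diamond z,$$ $$x\bullet\{\!\!\{y,z\}\!\!\}+y\bullet\{\!\!\{z,x\}\!\!\}+z\bullet\{\!\!\{x,y\}\!\!\}+x\diamond(y\bullet z)+y\diamond(z\bullet x)+z\diamond(x\bullet y)=0.$$ An NS-Poisson algebra is a quintuple $(A,\ast,\curlyvee,\diamond,\bullet)$ such that $(A,\ast,\curlyvee)$ is an NS-commutative algebra, $(A,\diamond,\bullet)$ is an NS-Lie algebra, and for all $x,y,z\in A$, with $x\odot y=x\ast y+y\ast x+x\curlyvee y$ and $\{\!\!\{x,y\}\!\!\}=x\diamond y-y\diamond x+x\bullet y$: $$\{\!\!\{x,y\}\!\!\}\ast z=x\diamond(y\ast z)-y\ast(x\diamond z),$$ $$(x\odot y)\diamond z=x\ast(y\diamond z)+y\ast(x\diamond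 z),$$ $$x\bullet(y\odot z)+x\diamond(y\curlyvee z)=\{\!\!\{x,y\}\!\!\}\curlyvee z+z\ast(x\bullet y)+y\curlyvee\{\!\!\{x,z\}\!\!\}+y\ast(x\bullet z).$$ *)

(* Defs.v *)
From HB Require Import structures.
From mathcomp Require Import all_boot all_order all_algebra.
From mathcomp Require Import boolp.

Set Implicit Arguments.
Unset Strict Implicit.
Unset Printing Implicit Defensive.

Import GRing.Theory.

Local Open Scope ring_scope.

(* V[[t]]; it serves both for the ring k[[t]] and for the k[[t]]-module A[[t]].
   It is a record rather than an alias of nat -> V so that it does not inherit
   the pointwise product and pointwise scaling of functions. *)
Record fps (V : Type) := Fps { fps_coef :> nat -> V }.

Lemma fpsP (V : Type) (u v : fps V) : (forall n, u n = v n) -> u = v.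
Proof. by case: u v => [u] [v] /= uv; congr Fps; apply: funext. Qed.

HB.instance Definition _ (V : Type) := gen_eqMixin (fps V).
HB.instance Definition _ (V : Type) := gen_choiceMixin (fps V).

Section FpsZmodule.
Variable V : zmodType.
Implicit Types u v w : fps V.

Definition fps_zero : fps V := Fps (fun=> 0).
Definition fps_opp u : fps V := Fps (fun n => - u n).
Definition fps_add u v : fps V := Fps (fun n => u n + v n).

Fact fps_addA : associative fps_add.
Proof. by move=> u v w; apply: fpsP => n /=; rewrite addrA. Qed.
Fact fps_addC : commutative fps_add.
Proof. by move=> u v; apply: fpsP => n /=; rewrite addrC. Qed.
Fact fps_add0 : left_id fps_zero fps_add.
Proof. by move=> u; apply: fpsP => n /=; rewrite add0r. Qed.
Fact fps_addN : left_inverse fps_zero fps_opp fps_add.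
Proof. by move=> u; apply: fpsP => n /=; rewrite addNr. Qed.

HB.instance Definition _ :=
  GRing.isZmodule.Build (fps V) fps_addA fps_addC fps_add0 fps_addN.

Definition fps_const (x : V) : fps V := Fps (fun n => if n is 0 then x else 0).

End FpsZmodule.

Section FpsScale.
Variables (R : comNzRingType) (V : lmodType R).
Implicit Types (a b : fps R) (u v : fps V).

Definition fps_scale a u : fps V :=
  Fps (fun n => \sum_(i < n.+1) a i *: u (n - i)%N).

Lemma fps_scale_rev a u n :
  fps_scale a u n = \sum_(i < n.+1) a (n - i)%N *: u i.
Proof.
rewrite /= (reindex_inj rev_ord_inj) /=.
by apply: eq_bigr => i _; rewrite subSS subKn // -ltnS.
Qed.

Lemma fps_scale_const x u n : fps_scale (fps_const x) u n = x *: u n.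
Proof.
by rewrite /= big_ord_recl /= subn0 big1 ?addr0 // => i _; rewrite scale0r.
Qed.

Lemma fps_scaleDr a : {morph fps_scale a : u v / u + v}.
Proof.
move=> u v; apply: fpsP => n /=; rewrite -big_split /=.
by apply: eq_bigr => i _; rewrite scalerDr.
Qed.

Lemma fps_scaleDl u : {morph fps_scale^~ u : a b / a + b}.
Proof.
move=> a b; apply: fpsP => n /=; rewrite -big_split /=.
by apply: eq_bigr => i _; rewrite scalerDl.
Qed.

End FpsScale.

Section FpsRing.
Variable R : comNzRingType.
Implicit Types a b c : fps R.

Definition fps_mul a b : fps R :=
  Fps (fun n => \sum_(i < n.+1) a i * b (n - i)%N).

Lemma fps_scaleA (V : lmodType R) a b (u : fps V) :
  fps_scale a (fps_scale b u) = fps_scale (fps_mul a b) u.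
Proof.
apply: fpsP => n; rewrite [RHS]fps_scale_rev.
pose m j k := a j *: (b (n - j - k)%N *: u k).
transitivity (\sum_(j < n.+1) \sum_(k < n.+1 | (k <= n - j)%N) m j k).
  apply: eq_bigr => j _; rewrite fps_scale_rev scaler_sumr.
  by rewrite (big_ord_narrow_leq (leq_subr _ _)).
rewrite (exchange_big_dep predT) //=; apply: eq_bigr => k _.
transitivity (\sum_(j < n.+1 | (j <= n - k)%N) m j k).
  apply: eq_bigl => j; rewrite -ltnS -(ltnS j) -!subSn ?leq_ord //.
  by rewrite -subn_gt0 -(subn_gt0 j) -!subnDA addnC.
rewrite (big_ord_narrow_leq (leq_subr _ _)) scaler_suml.
by apply: eq_bigr => j _; rewrite /m -!subnDA addnC scalerA.
Qed.

Fact fps_mulA : associative fps_mul.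
Proof. by move=> a b c; exact: (@fps_scaleA R^o). Qed.
Fact fps_mulC : commutative fps_mul.
Proof.
move=> a b; apply: fpsP => n; rewrite [LHS](@fps_scale_rev _ R^o).
by apply: eq_bigr => i _; rewrite mulrC.
Qed.
Fact fps_mul1 : left_id (fps_const 1) fps_mul.
Proof.
move=> a; apply: fpsP => n.
by rewrite [LHS](@fps_scale_const _ R^o) scale1r.
Qed.
Fact fps_mulDl : left_distributive fps_mul +%R.
Proof. by move=> a b c; exact: (@fps_scaleDl _ R^o). Qed.
Fact fps_1_neq0 : fps_const (1 : R) != 0.
Proof. by apply/eqP => /(congr1 (fun s => fps_coef s 0%N)) /eqP; rewrite oner_eq0. Qed.

HB.instance Definition _ := GRing.Zmodule_isComNzRing.Build (fps R)
  fps_mulA fps_mulC fps_mul1 fps_mulDl fps_1_neq0.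

Definition fps_t : fps R := Fps (fun n => (n == 1)%:R).

End FpsRing.

Arguments fps_t {R}.

Section FpsLmodule.
Variables (R : comNzRingType) (V : lmodType R).

Fact fps_scale1 : left_id (1 : fps R) (@fps_scale R V).
Proof. by move=> u; apply: fpsP => n; rewrite fps_scale_const scale1r. Qed.

HB.instance Definition _ := GRing.Zmodule_isLmodule.Build (fps R) (fps V)
  (@fps_scaleA R V) fps_scale1 (@fps_scaleDr R V) (@fps_scaleDl R V).

End FpsLmodule.

Definition bilinear_op (R : comNzRingType) (A : lmodType R) (f : A -> A -> A)
  : Prop := bilinear_for *:%R *:%R f.

Section NSAlgebra.
Variables (R : comNzRingType) (A : lmodType R) (prec succ curly : A -> A -> A).

Local Notation "x ≺ y" := (prec x y) (at level 40).
Local Notation "x ≻ y" := (succ x y) (at level 40).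
Local Notation "x ⋎ y" := (curly x y) (at level 40).
Local Notation "x ⊙ y" := ((x ≺ y) + (x ≻ y) + (x ⋎ y)) (at level 40).

Record NS_algebra : Prop := {
  NS_prec_bilinear : bilinear_op prec;
  NS_succ_bilinear : bilinear_op succ;
  NS_curly_bilinear : bilinear_op curly;
  NS_precA : forall x y z, (x ≺ y) ≺ z = x ≺ (y ⊙ z);
  NS_succ_precA : forall x y z, (x ≻ y) ≺ z = x ≻ (y ≺ z);
  NS_succA : forall x y z, (x ⊙ y) ≻ z = x ≻ (y ≻ z);
  NS_curlyA : forall x y z,
    ((x ⋎ y) ≺ z) + ((x ⊙ y) ⋎ z) = (x ≻ (y ⋎ z)) + (x ⋎ (y ⊙ z))
}.

End NSAlgebra.

Section NSPoisson.
Variables (R : comNzRingType) (A : lmodType R).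
Variables star curly diamond bullet : A -> A -> A.

Local Notation "x ∗ y" := (star x y) (at level 40).
Local Notation "x ⋎ y" := (curly x y) (at level 40).
Local Notation "x ⋄ y" := (diamond x y) (at level 40).
Local Notation "x • y" := (bullet x y) (at level 40).
Local Notation "x ⊙ y" := ((x ∗ y) + (y ∗ x) + (x ⋎ y)) (at level 40).
Local Notation "⦃ x , y ⦄" := ((x ⋄ y) - (y ⋄ x) + (x • y))
  (at level 0, x at level 99, y at level 99).

Record NS_commutative_algebra : Prop := {
  NSC_star_bilinear : bilinear_op star;
  NSC_curly_bilinear : bilinear_op curly;
  NSC_curlyC : forall x y, x ⋎ y = y ⋎ x;
  NSC_starA : forall x y z, x ∗ (y ∗ z) = (x ⊙ y) ∗ z;
  NSC_star_curly : forall x y z,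
    (x ∗ (y ⋎ z)) + (x ⋎ (y ⊙ z)) = (y ∗ (x ⋎ z)) + (y ⋎ (x ⊙ z))
}.

Record NS_Lie_algebra : Prop := {
  NSL_diamond_bilinear : bilinear_op diamond;
  NSL_bullet_bilinear : bilinear_op bullet;
  NSL_bullet_skew : forall x y, x • y = - (y • x);
  NSL_diamond : forall x y z,
    (x ⋄ (y ⋄ z)) - ((x ⋄ y) ⋄ z) - (y ⋄ (x ⋄ z)) + ((y ⋄ x) ⋄ z)
    = (x • y) ⋄ z;
  NSL_jacobi : forall x y z,
    (x • ⦃y, z⦄) + (y • ⦃z, x⦄) + (z • ⦃x, y⦄)
    + (x ⋄ (y • z)) + (y ⋄ (z • x)) + (z ⋄ (x • y)) = 0
}.

Record NS_Poisson_algebra : Prop := {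
  NSP_commutative : NS_commutative_algebra;
  NSP_Lie : NS_Lie_algebra;
  NSP_bracket_star : forall x y z,
    ⦃x, y⦄ ∗ z = (x ⋄ (y ∗ z)) - (y ∗ (x ⋄ z));
  NSP_odot_diamond : forall x y z,
    (x ⊙ y) ⋄ z = (x ∗ (y ⋄ z)) + (y ∗ (x ⋄ z));
  NSP_leibniz : forall x y z,
    (x • (y ⊙ z)) + (x ⋄ (y ⋎ z))
    = (⦃x, y⦄ ⋎ z) + (z ∗ (x • y)) + (y ⋎ ⦃x, z⦄) + (y ∗ (x • z))
}.

End NSPoisson.

(* The operation f of A[[t]] restricts on A to x, y |-> \sum_i (f_ i x y) t^i *)
Definition expands_as (R : comNzRingType) (A : lmodType R)
    (f : fps A -> fps A -> fps A) (f_ : nat -> A -> A -> A) : Prop :=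
  forall x y, f (fps_const x) (fps_const y) = Fps (fun i => f_ i x y).

Record NS_algebra_deformation (k : fieldType) (A : lmodType k)
    (star curly0 : A -> A -> A)
    (prec_ succ_ curly_ : nat -> A -> A -> A)
    (prec_t succ_t curly_t : fps A -> fps A -> fps A) : Prop := {
  NSD_prec_bilinear : forall i, bilinear_op (prec_ i);
  NSD_succ_bilinear : forall i, bilinear_op (succ_ i);
  NSD_curly_bilinear : forall i, bilinear_op (curly_ i);
  NSD_prec_expand : expands_as prec_t prec_;
  NSD_succ_expand : expands_as succ_t succ_;
  NSD_curly_expand : expands_as curly_t curly_;
  NSD_prec0 : forall x y, prec_ 0 x y = star y x;
  NSD_succ0 : forall x y, succ_ 0 x y = star x y;
  NSD_curly0 : forall x y, curly_ 0 x y = curly0 x y;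
  NSD_NS_algebra : @NS_algebra (fps k) (fps A) prec_t succ_t curly_t
}.

(* (s / t)|_{t = 0} = x, which includes the divisibility of s by t; the
   quotient q is unique because t is not a zero divisor on A[[t]]. *)
Definition div_t_at0 (R : comNzRingType) (A : lmodType R) (s : fps A) (x : A)
  : Prop := exists2 q : fps A, s = (fps_t : fps R) *: q & q 0%N = x.

(* Main.v *)
Require Import Defs.
From HB Require Import structures.
From mathcomp Require Import all_boot all_order all_algebra.

Set Implicit Arguments.
Unset Strict Implicit.
Unset Printing Implicit Defensive.

Import GRing.Theory.

Local Open Scope ring_scope.

(** The idea is that an NS-algebra satisfies, for its own commutators
      x ⋄ y = x ≻ y - y ≺ x   and   x • y = x ⋎ y - y ⋎ x,
    noncommutative forms of all the NS-Poisson identities.  Put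
    x ⊙ y = x ≺ y + x ≻ y + x ⋎ y; then ⦃x, y⦄ = x ⋄ y - y ⋄ x + x • y is the
    ordinary commutator x ⊙ y - y ⊙ x, and
      ⦃x, y⦄ ≻ z = x ⋄ (y ≻ z) - y ≻ (x ⋄ z),
      (x ⊙ y) ⋄ z = x ≻ (y ⋄ z) + (x ⋄ z) ≺ y,
      x • (y ⊙ z) + x ⋄ (y ⋎ z)
        = ⦃x, y⦄ ⋎ z + (x • y) ≺ z + y ⋎ ⦃x, z⦄ + y ≻ (x • z)
    hold exactly ([bracket_succ], [odot_diamond], [NS_leibniz]), while ⋄ and •
    form an NS-Lie algebra ([divided_commutators_NS_Lie]).

    In these three identities every term is of degree 1 in the commutators, and
    in the NS-Lie axioms it is of degree 2 (of degree 1 for skew-symmetry).  They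
    therefore persist when the commutators are divided by a common scalar t,
    provided that multiplication by t is injective.

    In the deformation, the commutators vanish at t = 0, because the algebra
    being deformed is commutative in the NS sense; so they are t times
    k[[t]]-bilinear operations D and B ([bilinear_op_shift]), to which the
    identities apply.  The value at t = 0 of a k[[t]]-bilinear operation
    depends only on the constant terms of its arguments ([bilinear_op_coef0]),
    so setting t = 0 is a homomorphism from A[[t]] to A for all the operations
    involved.  It carries ≻, ≺, ⋎, D and B to the product, its opposite,
    the given commutative operation, and the two operations of the theorem, and
    the identities of A[[t]] become those of an NS-Poisson algebra. *)

(** * Bilinear operations *)

Section BilinearOp.
Variables (R : comNzRingType) (A : lmodType R) (f : A -> A -> A).
Hypothesis fL : bilinear_op f.

Let F : {bilinear A -> A -> A | *:%R & *:%R} :=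
  HB.pack f (@bilinear_isBilinear.Build R A A A *:%R *:%R f fL).

Lemma bilinear_opDl x y z : f (x + y) z = f x z + f y z.
Proof. exact: (linearDl F). Qed.
Lemma bilinear_opDr x y z : f x (y + z) = f x y + f x z.
Proof. exact: (linearDr F). Qed.
Lemma bilinear_opBl x y z : f (x - y) z = f x z - f y z.
Proof. exact: (linearBl F). Qed.
Lemma bilinear_opBr x y z : f x (y - z) = f x y - f x z.
Proof. exact: (linearBr F). Qed.
Lemma bilinear_opZl a x y : f (a *: x) y = a *: f x y.
Proof. exact: (linearZl_LR F). Qed.
Lemma bilinear_opZr a x y : f x (a *: y) = a *: f x y.
Proof. exact: (linearZr_LR F). Qed.

Lemma bilinear_op_flip : bilinear_op (fun x y => f y x).
Proof.
split=> x a y z; first by rewrite bilinear_opDr bilinear_opZr.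
by rewrite bilinear_opDl bilinear_opZl.
Qed.

Lemma bilinear_op_sub g : bilinear_op g -> bilinear_op (fun x y => f x y - g x y).
Proof.
move=> [gl gr]; split=> x a y z.
  by rewrite bilinear_opDl bilinear_opZl gl /= scalerBr opprD addrACA.
by rewrite bilinear_opDr bilinear_opZr gr /= scalerBr opprD addrACA.
Qed.

End BilinearOp.

(** * Commutators of an NS-algebra divided by a scalar *)

Section DividedCommutators.
Variables (R : comNzRingType) (A : lmodType R) (prec succ curly : A -> A -> A).
Hypothesis hA : NS_algebra prec succ curly.
Variables (t : R) (diamond bullet : A -> A -> A).
Hypothesis tI : injective (fun u : A => t *: u).
Hypothesis diamondL : bilinear_op diamond.
Hypothesis bulletL : bilinear_op bullet.

Local Notation "x ≺ y" := (prec x y) (at level 40).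
Local Notation "x ≻ y" := (succ x y) (at level 40).
Local Notation "x ⋎ y" := (curly x y) (at level 40).
Local Notation "x ⊙ y" := ((x ≺ y) + (x ≻ y) + (x ⋎ y)) (at level 40).
Local Notation "x ⋄ y" := (diamond x y) (at level 40).
Local Notation "x • y" := (bullet x y) (at level 40).
Local Notation "⦃ x , y ⦄" := ((x ⋄ y) - (y ⋄ x) + (x • y))
  (at level 0, x at level 99, y at level 99).

Hypothesis t_diamond : forall x y, t *: (x ⋄ y) = (x ≻ y) - (y ≺ x).
Hypothesis t_bullet : forall x y, t *: (x • y) = (x ⋎ y) - (y ⋎ x).

Let precL := NS_prec_bilinear hA.
Let succL := NS_succ_bilinear hA.
Let curlyL := NS_curly_bilinear hA.

(** The link to the associative product: all the identities below come from
    evaluating the commutator of ⊙ by means of the NS axioms. *)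
Lemma t_bracket x y : t *: ⦃x, y⦄ = (x ⊙ y) - (y ⊙ x).
Proof.
rewrite scalerDr scalerBr !t_diamond t_bullet opprB.
rewrite (addrACA (x ≻ y)) [LHS]addrACA -!opprD.
by rewrite [(x ≻ y) + _]addrC.
Qed.

(** Both sides, times t, are (x ⊙ y) ≻ z - (y ⊙ x) ≻ z: on the right the mixed
    terms (y ≻ z) ≺ x and y ≻ (z ≺ x) cancel. *)
Lemma bracket_succ x y z :
  (⦃x, y⦄ ≻ z) = (x ⋄ (y ≻ z)) - (y ≻ (x ⋄ z)).
Proof.
apply: tI; rewrite -(bilinear_opZl succL) t_bracket scalerBr.
rewrite -(bilinear_opZr succL) !t_diamond (bilinear_opBl succL).
rewrite (bilinear_opBr succL) -(NS_succ_precA hA) !(NS_succA hA).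
by rewrite opprB addrA subrK.
Qed.

(** The mirror image of [bracket_succ], with the action of y on z taken from
    the right; the two together give [bracket_diamond]. *)
Lemma bracket_prec x y z :
  (z ≺ ⦃x, y⦄) = (x ⋄ (z ≺ y)) - ((x ⋄ z) ≺ y).
Proof.
apply: tI; rewrite -(bilinear_opZr precL) t_bracket scalerBr.
rewrite -(bilinear_opZl precL) !t_diamond (bilinear_opBl precL).
rewrite (bilinear_opBr precL) (NS_succ_precA hA) !(NS_precA hA).
by rewrite opprB [RHS]addrC addrA subrK.
Qed.

(** Times t, both sides are x ≻ (y ≻ z) - (z ≺ x) ≺ y. *)
Lemma odot_diamond x y z :
  ((x ⊙ y) ⋄ z) = (x ≻ (y ⋄ z)) + ((x ⋄ z) ≺ y).
Proof.
apply: tI; rewrite scalerDr -(bilinear_opZr succL) -(bilinear_opZl precL).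
rewrite !t_diamond (bilinear_opBr succL) (bilinear_opBl precL).
by rewrite (NS_succA hA) (NS_succ_precA hA) (NS_precA hA) addrA subrK.
Qed.

(* The right-hand side of the mixed axiom for ⋎; by that axiom it also stands
   for the left-hand side. *)
Let L x y z := (x ≻ (y ⋎ z)) + (x ⋎ (y ⊙ z)).

(** The terms in which x acts on the left form L x y z, and those in which it
    acts on the right form the left-hand side of the mixed axiom at (y, z, x).
    This reduces both the Leibniz rule and the Jacobi identity for • to
    cancellations among values of L. *)
Lemma t_bullet_odot x y z :
  t *: ((x • (y ⊙ z)) + (x ⋄ (y ⋎ z))) = L x y z - L y z x.
Proof.
rewrite scalerDr t_diamond t_bullet /L -(NS_curlyA hA y) addrACA -opprD.
by congr (_ - _); rewrite addrC.
Qed.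

(** Times t, the terms on the right group into the two differences
    L x y z - L y x z and L y x z - L y z x. *)
Lemma NS_leibniz x y z :
  (x • (y ⊙ z)) + (x ⋄ (y ⋎ z))
  = (⦃x, y⦄ ⋎ z) + ((x • y) ≺ z) + (y ⋎ ⦃x, z⦄) + (y ≻ (x • z)).
Proof.
apply: tI; rewrite t_bullet_odot !scalerDr -[RHS]addrA.
rewrite -(bilinear_opZl curlyL) -(bilinear_opZr curlyL).
rewrite -(bilinear_opZl precL) -(bilinear_opZr succL).
rewrite !t_bracket !t_bullet (bilinear_opBl curlyL) (bilinear_opBr curlyL).
rewrite (bilinear_opBl precL) (bilinear_opBr succL) /L.
rewrite [X in _ = X + _]addrACA [X in _ = _ + X]addrACA.
rewrite -!opprD ![(_ ⋎ z) + _]addrC !(NS_curlyA hA).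
rewrite ![(y ⋎ _) + (y ≻ _)]addrC.
by rewrite addrA subrK.
Qed.

(** That ⋄ represents the bracket by operators on A is the first NS-Lie
    axiom. *)
Lemma bracket_diamond x y z :
  (⦃x, y⦄ ⋄ z) = (x ⋄ (y ⋄ z)) - (y ⋄ (x ⋄ z)).
Proof.
apply: tI; rewrite t_diamond bracket_succ bracket_prec scalerBr.
rewrite -(bilinear_opZr diamondL) t_diamond (bilinear_opBr diamondL) t_diamond.
by rewrite !opprB addrACA [RHS]addrACA [_ - (y ≻ _)]addrC.
Qed.

Lemma divided_commutators_NS_Lie : NS_Lie_algebra diamond bullet.
Proof.
split=> // [x y|x y z|x y z].
- by apply: tI; rewrite scalerN !t_bullet opprB.
- have := bracket_diamond x y z.
  rewrite (bilinear_opDl diamondL) (bilinear_opBl diamondL) => e.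
  rewrite (addrAC (x ⋄ (y ⋄ z))) -e -addrA [X in _ + X]addrC.
  by rewrite -(opprB ((x ⋄ y) ⋄ z)) addrC addKr.
(* Antisymmetrizing [t_bullet_odot] in its last two arguments gives one third
   of the Jacobi sum. *)
have K u v w : t *: (t *: ((u • ⦃v, w⦄) + (u ⋄ (v • w))))
    = (L u v w - L v w u) - (L u w v - L w v u).
  rewrite -!t_bullet_odot -scalerBr; congr (t *: _).
  rewrite scalerDr -(bilinear_opZr bulletL) -(bilinear_opZr diamondL).
  rewrite t_bracket t_bullet (bilinear_opBr bulletL) (bilinear_opBr diamondL).
  by rewrite addrACA -opprD.
apply: tI; apply: tI; rewrite !scaler0.
transitivity (t *: (t *: ((x • ⦃y, z⦄) + (x ⋄ (y • z))))
  + t *: (t *: ((y • ⦃z, x⦄) + (y ⋄ (z • x))))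
  + t *: (t *: ((z • ⦃x, y⦄) + (z ⋄ (x • y))))).
  rewrite -!scalerDr; do 2!congr (t *: _).
  by rewrite (addrACA (x • _)) [RHS]addrACA !addrA.
rewrite !K (addrACA (L x y z - _)) [LHS]addrACA -!opprD.
(* In the cyclic sum the values of L at even permutations of x, y, z
   telescope, and so do those at odd ones. *)
clearbody L.
by rewrite (addrC (L x z y - _)) !addrA !subrK !subrr.
Qed.

End DividedCommutators.

(** * Division by t and evaluation at t = 0 *)

Section PowerSeries.
Variables (R : comNzRingType) (A : lmodType R).
Implicit Types u v : fps A.

Definition fps_shift u : fps A := Fps (fun n => u n.+1).

Lemma fps_scaleE (a : fps R) u n :
  (a *: u) n = \sum_(i < n.+1) a i *: u (n - i)%N.
Proof. by []. Qed.

Lemma fps_scale_coef0 (a : fps R) u : (a *: u) 0%N = a 0%N *: u 0%N.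
Proof. by rewrite fps_scaleE big_ord1. Qed.

Lemma fps_tS u n : ((fps_t : fps R) *: u) n.+1 = u n.
Proof.
rewrite fps_scaleE !big_ord_recl /= scale0r add0r scale1r subSS subn0.
by rewrite big1 ?addr0 // => i _; rewrite scale0r.
Qed.

Lemma fps_t0 u : ((fps_t : fps R) *: u) 0%N = 0.
Proof. by rewrite fps_scale_coef0 scale0r. Qed.

Lemma fps_t_inj : injective (fun u : fps A => (fps_t : fps R) *: u).
Proof. by move=> u v e; apply: fpsP => n; rewrite -fps_tS e fps_tS. Qed.

Lemma fps_t_shift u : u 0%N = 0 -> (fps_t : fps R) *: fps_shift u = u.
Proof. by move=> u0; apply: fpsP => -[|n]; rewrite ?fps_t0 ?fps_tS. Qed.

Lemma fps_split u :
  u = fps_const (u 0%N) + (fps_t : fps R) *: fps_shift u.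
Proof.
apply: fpsP => -[|n].
  by rewrite -[RHS]/(u 0%N + _) fps_t0 addr0.
by rewrite -[RHS]/(0 + _) fps_tS add0r.
Qed.

(** Replacing the arguments by their constant terms changes the value by a
    multiple of t. *)
Lemma bilinear_op_coef0 (f : fps A -> fps A -> fps A) u v :
  @bilinear_op (fps R) (fps A) f ->
  (f u v) 0%N = (f (fps_const (u 0%N)) (fps_const (v 0%N))) 0%N.
Proof.
move=> fL; rewrite {1}(fps_split u) {1}(fps_split v).
rewrite (bilinear_opDl fL) (bilinear_opZl fL) (bilinear_opDr fL).
rewrite (bilinear_opZr fL) -[LHS]/((_ + _) + _) !fps_t0.
by rewrite !addr0.
Qed.

(** The quotient by t is again bilinear because multiplication by t is
    injective. *)
Lemma bilinear_op_shift (f : fps A -> fps A -> fps A) :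
    @bilinear_op (fps R) (fps A) f -> (forall u v, f u v 0%N = 0) ->
  @bilinear_op (fps R) (fps A) (fun u v => fps_shift (f u v)).
Proof.
move=> fL f0; split=> w a u v; apply: fps_t_inj => /=.
  rewrite (bilinear_opDl fL) (bilinear_opZl fL) scalerDr scalerA mulrC -scalerA.
  rewrite !fps_t_shift -?(bilinear_opZl fL) -?(bilinear_opDl fL) //.
rewrite (bilinear_opDr fL) (bilinear_opZr fL) scalerDr scalerA mulrC -scalerA.
by rewrite !fps_t_shift -?(bilinear_opZr fL) -?(bilinear_opDr fL).
Qed.

End PowerSeries.

(** * The semiclassical limit *)

Section SemiclassicalLimit.
Variables (R : comNzRingType) (A : lmodType R).
Variables (diamond bullet : A -> A -> A) (D B : fps A -> fps A -> fps A).
Hypothesis D0 : forall u v, D u v 0%N = diamond (u 0%N) (v 0%N).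
Hypothesis B0 : forall u v, B u v 0%N = bullet (u 0%N) (v 0%N).

(** Evaluation at t = 0 is a surjective homomorphism, with the constant series
    as preimages. *)
Lemma NS_Lie_coef0 :
    bilinear_op diamond -> bilinear_op bullet ->
    @NS_Lie_algebra (fps R) (fps A) D B ->
  NS_Lie_algebra diamond bullet.
Proof.
move=> dL bL [_ _ skew dia jac]; split=> // [x y|x y z|x y z].
- have := congr1 (fun u : fps A => u 0%N) (skew (fps_const x) (fps_const y)).
  by rewrite /= !B0.
- have := congr1 (fun u : fps A => u 0%N)
    (dia (fps_const x) (fps_const y) (fps_const z)).
  by rewrite /= !D0 !B0.
have := congr1 (fun u : fps A => u 0%N)
  (jac (fps_const x) (fps_const y) (fps_const z)).
by rewrite /= !D0 !B0 /= !D0 !B0.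
Qed.

End SemiclassicalLimit.

Theorem theorem4p1 (k : fieldType) (char0 : [pchar k] =i pred0)
    (A : lmodType k) (star curly0 : A -> A -> A)
    (prec_ succ_ curly_ : nat -> A -> A -> A)
    (prec_t succ_t curly_t : fps A -> fps A -> fps A)
    (hA : NS_commutative_algebra star curly0)
    (hdef : NS_algebra_deformation star curly0 prec_ succ_ curly_
              prec_t succ_t curly_t) :
  let diamond x y := succ_ 1%N x y - prec_ 1%N y x in
  let bullet x y := curly_ 1%N x y - curly_ 1%N y x in
  [/\ forall x y, div_t_at0 (succ_t (fps_const x) (fps_const y)
                             - prec_t (fps_const y) (fps_const x)) (diamond x y),
      forall x y, div_t_at0 (curly_t (fps_const x) (fps_const y)
                             - curly_t (fps_const y) (fps_const x)) (bullet x y)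
    & NS_Poisson_algebra star curly0 diamond bullet].
Proof.
move=> diamond bullet.
case: hdef => p_L s_L c_L pE sE cE p0 s0 c0 hNS.
have [pL sL cL] := And3 (NS_prec_bilinear hNS) (NS_succ_bilinear hNS)
  (NS_curly_bilinear hNS).
have P0 u v : prec_t u v 0%N = star (v 0%N) (u 0%N).
  by rewrite bilinear_op_coef0 // pE /= p0.
have S0 u v : succ_t u v 0%N = star (u 0%N) (v 0%N).
  by rewrite bilinear_op_coef0 // sE /= s0.
have C0 u v : curly_t u v 0%N = curly0 (u 0%N) (v 0%N).
  by rewrite bilinear_op_coef0 // cE /= c0.
(* The commutators of the deformation, then their quotients by t. *)
pose dcom u v := succ_t u v - prec_t v u.
pose bcom u v := curly_t u v - curly_t v u.
have dcom0 u v : dcom u v 0%N = 0.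
  by rewrite -[LHS]/(_ - _) S0 P0 subrr.
have bcom0 u v : bcom u v 0%N = 0.
  by rewrite -[LHS]/(_ - _) !C0 (NSC_curlyC hA) subrr.
pose D u v := fps_shift (dcom u v).
pose B u v := fps_shift (bcom u v).
have tD u v : (fps_t : fps k) *: D u v = dcom u v by apply: fps_t_shift.
have tB u v : (fps_t : fps k) *: B u v = bcom u v by apply: fps_t_shift.
have DL : @bilinear_op (fps k) (fps A) D.
  apply: bilinear_op_shift dcom0.
  exact (bilinear_op_sub sL (bilinear_op_flip pL)).
have BL : @bilinear_op (fps k) (fps A) B.
  apply: bilinear_op_shift bcom0.
  exact (bilinear_op_sub cL (bilinear_op_flip cL)).
have Dc x y : D (fps_const x) (fps_const y) 0%N = diamond x y.
  by rewrite /D /dcom sE pE.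
have Bc x y : B (fps_const x) (fps_const y) 0%N = bullet x y.
  by rewrite /B /bcom !cE.
have D0 u v : D u v 0%N = diamond (u 0%N) (v 0%N).
  by rewrite bilinear_op_coef0.
have B0 u v : B u v 0%N = bullet (u 0%N) (v 0%N).
  by rewrite bilinear_op_coef0.
(* From here on D and B are known only through their products by t and their
   values at t = 0; simplification must not unfold them to coefficients of
   degree 1. *)
clearbody D B.
have tI := @fps_t_inj k A.
pose at0 (u : fps A) := u 0%N.
split=> [x y|x y|].
- by exists (D (fps_const x) (fps_const y)); rewrite ?tD ?Dc.
- by exists (B (fps_const x) (fps_const y)); rewrite ?tB ?Bc.
split=> // [|x y z|x y z|x y z].
- apply: (NS_Lie_coef0 D0 B0); last exact: (divided_commutators_NS_Lie hNS tI).
    exact (bilinear_op_sub (s_L 1%N) (bilinear_op_flip (p_L 1%N))).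
  exact (bilinear_op_sub (c_L 1%N) (bilinear_op_flip (c_L 1%N))).
- have /(congr1 at0) := bracket_succ hNS tI tD tB
    (fps_const x) (fps_const y) (fps_const z).
  by rewrite /at0 /= !(S0, D0, B0) /= !(S0, D0, B0).
- have /(congr1 at0) := odot_diamond hNS tI tD
    (fps_const x) (fps_const y) (fps_const z).
  rewrite /at0 /= !(S0, P0, D0) /= !(S0, P0, D0, C0) /=.
  by rewrite (addrC (star y x)).
have /(congr1 at0) := NS_leibniz hNS tI tD tB
  (fps_const x) (fps_const y) (fps_const z).
rewrite /at0 /= !(S0, P0, D0, B0, C0) /= !(S0, P0, D0, B0, C0) /=.
by rewrite (addrC (star z y)).
Qed.
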